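(* Let $\mathcal{H}$ be a Hilbert space, $\mathcal{Y}\subset\mathcal{H}$ a non-empty set, and consider $f: \mathcal{Y} \to \mathcal{H}$. Let $h:\mathcal{H}\to\mathbb{R}\cup\{+\infty\}$ be a proper convex function that is differentiable on its open domain $\mathrm{dom}(h)$. Let $D_h$ be the Bregman divergence associated with $h$. (a) The following properties are equivalent: (i) there is $\varphi: \mathcal{H} \to \mathbb{R} \cup \{+\infty\}$ such that $f(y) \in \arg\min_{x \in \mathcal{H}} \{D_h (x,y)+\varphi(x)\}$ for all $y \in \mathcal{Y}$; (ii) there is a convex lower semicontinuous $g: \mathcal{H} \to \mathbb{R} \cup \{+\infty\}$ such that $\nabla h(f^{-1}(x))\subset \partial g(x)$ for all $x \in \mathrm{Im}(f)$. When they hold, $\varphi$ (resp. $g$) can be chosen given $g$ (resp. $\varphi$) so that $g(x)+\chi_{\mathrm{Im}(f)}(x) = h(x)+\varphi(x)$. (b) Let $\varphi$ and $g$ satisfy (a)(i) and (a)(ii), respectively, and let $\mathcal{C} \subset \mathrm{Im}(f)$ be polygonally connected. Then there is $K \in \mathbb{R}$ such that $g(x) = h(x)+\varphi(x) + K$ for all $x \in \mathcal{C}$. (c) The following properties are equivalent: (i) there is $\varphi: \mathcal{H} \to \mathbb{R} \cup \{+\infty\}$ such that $f(y) \in \arg\min_{x \in \mathcal{H}} \{D_h(y,x)+\varphi(x)\}$ for all $y \in \mathcal{Y}$; (ii) there is a convex lower semicontinuous $\psi: \mathcal{H} \to \mathbb{R} \cup \{+\infty\}$ such that $\nabla h(f(y))\in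 \partial \psi(y)$ for all $y \in \mathcal{Y}$. $\varphi$ can be chosen given $\psi$ (resp. $\psi$ given $\varphi$) such that $\psi(y) = \langle \nabla h(f(y)),y-f(y)\rangle+h(f(y))-\varphi(f(y))$ for all $y \in \mathcal{Y}$. (d) Let $\varphi$ and $\psi$ satisfy (c)(i) and (c)(ii), respectively, and let $\mathcal{C}' \subset \mathcal{Y}$ be polygonally connected. Then there is $K' \in \mathbb{R}$ such that $\psi(y) =\langle\nabla h(f(y)),y-f(y) \rangle+h(f(y))-\varphi(f(y)) + K'$ for all $y \in \mathcal{C}'$.
   Context: $\mathrm{dom}(h)=\{x\in\mathcal{H}:h(x)<+\infty\}$; proper means $\mathrm{dom}(h)\neq\varnothing$. The Bregman divergence $D_h:\mathcal{H}\times\mathcal{H}\to[0,+\infty]$ is $D_h(x,y)=h(x)-h(y)-\langle\nabla h(y),x-y\rangle$ if $y\in\mathrm{dom}(h)$, and $D_h(x,y)=+\infty$ otherwise. $\nabla h(z)$ is the gradient of $h$ at $z\in\mathrm{dom}(h)$; at points $z\notin\mathrm{dom}(h)$ it is replaced by an arbitrary element of $\mathcal{H}$. $\mathrm{Im}(f)=f(\mathcal{Y})$, $f^{-1}(x)=\{y\in\mathcal{Y}: f(y)=x\}$, $\nabla h(f^{-1}(x))=\{\nabla h(y):y\in f^{-1}(x)\}$. $\chi_{\mathcal S}(x)=0$ if $x\in\mathcal S$ and $+\infty$ otherwise. $\arg\min$ denotes the set of global minimizers. For $\theta:\mathcal{H}\to\mathbb{R}\cup\{+\infty\}$, the subdifferential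 $\partial\theta(x)$ is the set of all $u\in\mathcal{H}$ such that $\theta(x')\geq\theta(x)+\langle u,x'-x\rangle$ for all $x'\in\mathcal{H}$, with $\partial\theta(x)=\varnothing$ when $\theta(x)=+\infty$. A non-empty subset $\mathcal{C}\subset\mathcal{H}$ is polygonally connected if any two points $x,x'\in\mathcal{C}$ can be joined by a polygonal path in $\mathcal{C}$, i.e. there are $x_0=x,x_1,\dots,x_n=x'$ with each segment $[x_{i-1},x_i]=\{t x_{i-1}+(1-t)x_i: t\in[0,1]\}\subset\mathcal{C}$.
   Formalization: Y and Im(f) are assumed inside dom(h) for (ii)⇒(i) and for choosing φ from g or ψ; argmin requires a finite minimum value; when g is chosen given φ, g+χ=h+φ is asserted only on Im(f). As written these claims fail, e.g. h=-ln, Y={-1}; φ≡+∞; or f=id on {0}, φ=0. *)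

(* Defs.v *)
(* MathComp-Analysis world. *)
From HB Require Import structures.
From mathcomp Require Import all_boot all_order all_algebra.
From mathcomp Require Import all_classical all_reals all_analysis.

Set Implicit Arguments.
Unset Strict Implicit.
Unset Printing Implicit Defensive.

Import Order.TTheory GRing.Theory Num.Theory.
Import numFieldNormedType.Exports.

Local Open Scope classical_set_scope.
Local Open Scope ring_scope.
Local Open Scope ereal_scope.

(* A real Hilbert space is a complete normed space [H] together with a
   symmetric positive definite form [ip : {dot H for idfun}] that induces the
   norm. *)
Definition induces_norm (R : realType) (H : completeNormedModType R)
    (ip : {dot H for idfun}) : Prop :=
  forall x : H, (ip x x = `|x| ^+ 2)%R.

Section extended_functions.
Context {R : realType} {H : completeNormedModType R}.
Implicit Types (g h theta : H -> \bar R) (C S : set H).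

(* A function H -> R u {+oo} is a function H -> \bar R avoiding -oo. *)
Definition avoids_ninfty theta : Prop := forall x, theta x != -oo.

Definition dom theta : set H := [set x | theta x < +oo].

Definition econvex theta : Prop :=
  forall (x y : H) (t : R), (0 <= t <= 1)%R ->
    theta (t *: x + (1 - t) *: y)%R
      <= t%:E * theta x + (1 - t)%:E * theta y.

Definition chi S (x : H) : \bar R := if x \in S then 0 else +oo.

(* Global minimizers, with the usual convention that the function identically
   equal to +oo has none. *)
Definition argmin theta : set H :=
  [set x | theta x < +oo /\ forall x', theta x <= theta x'].

Definition polygonally_connected C : Prop :=
  C !=set0 /\
  forall x x', C x -> C x' ->
    exists (n : nat) (p : nat -> H),
      [/\ p 0%N = x, p n = x' &
        forall (i : nat) (t : R), (i < n)%N -> (0 <= t <= 1)%R ->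
          C (t *: p i + (1 - t) *: p i.+1)%R].

End extended_functions.

Section bregman.
Context {R : realType} {H : completeNormedModType R} (ip : {dot H for idfun}).
Implicit Types (g h theta phi psi : H -> \bar R) (gradh f : H -> H) (Y : set H).

Definition subdifferential theta (x : H) : set H :=
  [set u | theta x < +oo /\
           forall x', theta x + (ip u (x' - x)%R)%:E <= theta x'].

(* Frechet differentiability, with [u] the Riesz representative of the
   differential. When [dom h] is open and [h] avoids -oo, [fine \o h] and [h]
   agree near every point of [dom h]. *)
Definition is_gradient h (z u : H) : Prop :=
  differentiable (fine \o h) z /\
  forall v : H, ('d (fine \o h) z v = ip u v :> R)%R.

(* The values of [gradh] outside [dom h] are arbitrary. *)
Definition gradient_on_dom h gradh : Prop :=
  forall z, dom h z -> is_gradient h z (gradh z).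

Definition bregman h gradh (x y : H) : \bar R :=
  if h y < +oo then h x - h y - (ip (gradh y) (x - y)%R)%:E else +oo.

(* A map Y -> H is represented by a total [f : H -> H] of which only the values
   on [Y] are used; its image is [f @` Y], its fibre over [x] is
   [Y `&` f @^-1` [set x]]. *)

Definition left_bregman_prox h gradh Y f phi : Prop :=
  avoids_ninfty phi /\
  forall y, Y y -> argmin (fun x => bregman h gradh x y + phi x) (f y).

Definition left_potential gradh Y f g : Prop :=
  [/\ avoids_ninfty g, econvex g, lower_semicontinuous g &
      forall x, (f @` Y) x ->
        gradh @` (Y `&` f @^-1` [set x]) `<=` subdifferential g x].

Definition right_bregman_prox h gradh Y f phi : Prop :=
  avoids_ninfty phi /\
  forall y, Y y -> argmin (fun x => bregman h gradh y x + phi x) (f y).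

Definition right_potential gradh Y f psi : Prop :=
  [/\ avoids_ninfty psi, econvex psi, lower_semicontinuous psi &
      forall y, Y y -> subdifferential psi y (gradh (f y))].

(* By the two lemmas below, a penalty [phi] can only exist when [Y] and the
   image of [f] lie in [dom h]. A convex potential can exist without this: an
   affine function of slope [gradh y0] is one when [Y = [set y0]]. *)
Definition within_dom h Y f : Prop := Y `<=` dom h /\ f @` Y `<=` dom h.

Lemma left_bregman_prox_dom h gradh Y f phi : avoids_ninfty h ->
  left_bregman_prox h gradh Y f phi -> within_dom h Y f.
Proof.
move=> hN [phiN opt].
have fin y : Y y -> h y < +oo /\ h (f y) < +oo.
  move=> /opt[+ _]; rewrite /bregman; move: (phiN (f y)) (hN y) (hN (f y)).
  case: (phi (f y)) => [c||] //= _; case: (h y) => [a||] //= _;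
    by case: (h (f y)) => [b||] //= _; rewrite ?ltry ?ltxx.
by split=> [y /fin[]//|_ [y /fin[_ ?] <-]].
Qed.

Lemma right_bregman_prox_dom h gradh Y f phi : avoids_ninfty h ->
  right_bregman_prox h gradh Y f phi -> within_dom h Y f.
Proof.
move=> hN [phiN opt].
have fin y : Y y -> h y < +oo /\ h (f y) < +oo.
  move=> /opt[+ _]; rewrite /bregman; move: (phiN (f y)) (hN y) (hN (f y)).
  case: (phi (f y)) => [c||] //= _; case: (h y) => [a||] //= _;
    by case: (h (f y)) => [b||] //= _; rewrite ?ltry ?ltxx.
by split=> [y /fin[]//|_ [y /fin[_ ?] <-]].
Qed.

End bregman.

(* Main.v *)
(* Optimality of [f y] for [D_h(., y) + phi] says exactly that [gradh y] is a
   subgradient of [h + phi] at [f y], and optimality of [f y] for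
   [D_h(y, .) + phi] says that the affine functions
   [y' |-> rho y + <gradh (f y), y' - y>], with
   [rho y = <gradh (f y), y - f y> + h (f y) - phi (f y)], lie below [rho] on
   [Y].  In both cases the supremum of the affine minorants is the required
   convex lower semicontinuous potential.  Conversely a potential determines
   [phi] on the image of [f]; in (c) this is consistent because two points of
   the same fibre share the subgradient [gradh (f y)].  For (b) and (d), two
   functions with a common selection of subgradients along a segment differ by
   a constant there. *)
Require Import Defs.
From HB Require Import structures.
From mathcomp Require Import all_boot all_order all_algebra.
From mathcomp Require Import all_classical all_reals all_analysis.
From mathcomp Require Import ring lra.

Set Implicit Arguments.
Unset Strict Implicit.
Unset Printing Implicit Defensive.

Import Order.TTheory GRing.Theory Num.Theory.
Import numFieldNormedType.Exports.

Local Open Scope classical_set_scope.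
Local Open Scope ring_scope.
Local Open Scope ereal_scope.

(** * Algebra and continuity of the inner product *)

Section euclidean_inner_product.
Context {R : realType} {H : completeNormedModType R} (ip : {dot H for idfun}).

Lemma ipC (x y : H) : (ip x y = ip y x)%R.
Proof. by rewrite hermC /= expr0 mul1r. Qed.

Lemma ipDl (x y z : H) : (ip (x + y) z = ip x z + ip y z)%R.
Proof. exact: linearDl. Qed.

Lemma ipDr (x y z : H) : (ip x (y + z) = ip x y + ip x z)%R.
Proof. exact: linearDr. Qed.

Lemma ipBr (x y z : H) : (ip x (y - z) = ip x y - ip x z)%R.
Proof. exact: linearBr. Qed.

Lemma ipZr (x y : H) (t : R) : (ip x (t *: y) = t * ip x y)%R.
Proof. exact: linearZr_LR. Qed.

Lemma ip0r (x : H) : (ip x 0 = 0)%R.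
Proof. exact: linear0r. Qed.

Lemma polarization (ip_norm : induces_norm ip) (x y : H) :
  (ip x y = (`|x + y| ^+ 2 - `|x| ^+ 2 - `|y| ^+ 2) / 2)%R.
Proof.
rewrite -!ip_norm ipDl !ipDr (ipC y x).
by field.
Qed.

(** Polarization reduces this to continuity of the norm; it is what makes suprema of affine
    functions lower semicontinuous. *)
Lemma ip_continuous (ip_norm : induces_norm ip) (u : H) :
  continuous (fun x => ip u x : R).
Proof.
under eq_fun do rewrite polarization//.
move=> x; have sqr_norm_cvg (w : H) : (`|w + z| ^+ 2 @[z --> x] --> `|w + x| ^+ 2)%R.
  by under eq_fun do rewrite expr2; rewrite expr2;
    apply: cvgM; apply: cvg_norm; apply: cvgD => //; exact: cvg_cst.
apply: cvgMr_tmp; apply: cvgB; first by apply: cvgB => //; exact: cvg_cst.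
by have := sqr_norm_cvg 0%R; rewrite add0r; under eq_fun do rewrite add0r.
Qed.

End euclidean_inner_product.

(** * Convex interpolation of subgradients, and uniqueness up to constants *)

Section subgradients.
Context {R : realType} {H : completeNormedModType R} (ip : {dot H for idfun}).
Implicit Types (theta : H -> \bar R) (u x : H).

Lemma subdifferential_fin_num theta x u : avoids_ninfty theta ->
  subdifferential ip theta x u -> theta x \is a fin_num.
Proof. by move=> thetaN [thx _]; rewrite fin_numE thetaN -ltey. Qed.

Lemma subdifferential_fine theta x x' u : avoids_ninfty theta ->
  subdifferential ip theta x u -> theta x' \is a fin_num ->
  (ip u (x' - x) <= fine (theta x') - fine (theta x))%R.
Proof.
move=> thetaN thxu thx'; have thx := subdifferential_fin_num thetaN thxu.
have [_ /(_ x')] := thxu.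
by rewrite -(fineK thx) -(fineK thx') -EFinD lee_fin /=; lra.
Qed.

(** The witness is the supremum of the affine functions [a i] of slope [u i] with value [r i] at
    [p i]. Compatibility says that at [p i] none of them exceeds [r i], which [a i] attains.
    Indexing by [I] lets one point carry several slopes. *)
Lemma subgradient_interpolation (ip_norm : induces_norm ip) (I : Type)
    (D : set I) (p u : I -> H) (r : I -> R) : D !=set0 ->
  (forall i j, D i -> D j -> (r j + ip (u j) (p i - p j) <= r i)%R) ->
  exists g : H -> \bar R,
    [/\ avoids_ninfty g, econvex g, lower_semicontinuous g &
        forall i, D i ->
          g (p i) = (r i)%:E /\ subdifferential ip g (p i) (u i)].
Proof.
move=> [i0 Di0] compat.
pose a i x : R := (r i + ip (u i) (x - p i))%R.
pose g x := ereal_sup [set (a i x)%:E | i in D].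
have g_ge i x : D i -> (a i x)%:E <= g x.
  by move=> Di; apply: ereal_sup_ubound; exists i.
have gp i : D i -> g (p i) = (r i)%:E.
  move=> Di; apply/eqP; rewrite eq_le; apply/andP; split.
    by apply: ge_ereal_sup => _ [j Dj <-]; rewrite lee_fin; exact: compat.
  by have := g_ge i (p i) Di; rewrite /a subrr ip0r addr0.
exists g; split.
- by move=> x; apply/eqP => gx; have := g_ge i0 x Di0; rewrite gx.
- move=> x y t /andP[t0 t1]; apply: ge_ereal_sup => _ [j Dj <-].
  have -> : a j (t *: x + (1 - t) *: y)%R = (t * a j x + (1 - t) * a j y)%R.
    by rewrite /a !ipBr !ipDr !ipZr; ring.
  rewrite EFinD !EFinM; apply: leeD; apply: lee_wpmul2l;
    by rewrite ?g_ge// lee_fin// subr_ge0.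
(* If [c < g x], some [a j] exceeds [c] at [x], hence near [x] by continuity, and [g] dominates
   [a j]. *)
- move=> x c /ereal_sup_gt[_ [j Dj <-]]; rewrite lte_fin => caj.
  exists [set y | (c < a j y)%R].
    have aj_cvg : (a j y @[y --> x] --> a j x)%R.
      apply: cvgD; first exact: cvg_cst.
      under eq_fun do rewrite ipBr; rewrite ipBr.
      by apply: cvgB; [exact: ip_continuous|exact: cvg_cst].
    exact: (cvgr_gt (a j x)).
  by move=> y /= cajy; apply: lt_le_trans (g_ge j y Dj); rewrite lte_fin.
- move=> i Di; split; first exact: gp.
  split=> [|x]; rewrite gp// ?ltry//.
  exact: g_ge.
Qed.

(* On a subdivision of step 1/n, the increments of [a] and [b] over a cell
   [s, t] both lie between [v s / n] and [v t / n]; the gaps telescope to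
   [(v 1 - v 0) / n]. *)
Lemma le_increment_subgradient (a b v : R -> R) :
  (forall s t : R, 0 <= s <= 1 -> 0 <= t <= 1 -> v s * (t - s) <= a t - a s)%R ->
  (forall s t : R, 0 <= s <= 1 -> 0 <= t <= 1 -> v s * (t - s) <= b t - b s)%R ->
  (a 1 - a 0 <= b 1 - b 0)%R.
Proof.
move=> va vb.
have step n k : (k <= n.+1)%N ->
    (a (k%:R / n.+1%:R) - a 0 <=
     b (k%:R / n.+1%:R) - b 0 + (v (k%:R / n.+1%:R) - v 0) / n.+1%:R)%R.
  have in01 j : (j <= n.+1)%N -> (0 <= (j%:R / n.+1%:R : R) <= 1)%R.
    by move=> jn; rewrite divr_ge0//= ler_pdivrMr ?ltr0n// mul1r ler_nat.
  elim: k => [_|k IH kn]; first by rewrite !mul0r !subrr mul0r addr0.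
  have {}IH := IH (ltnW kn).
  (* The inequality at the right end of the cell bounds the increment of [a] from above; at the left
     end it bounds that of [b] from below. *)
  have upper := va _ _ (in01 _ kn) (in01 _ (ltnW kn)).
  have lower := vb _ _ (in01 _ (ltnW kn)) (in01 _ kn).
  have gap : (k.+1%:R / n.+1%:R - k%:R / n.+1%:R = n.+1%:R^-1 :> R)%R.
    by rewrite -mulrBl -natrB// subSnn mul1r.
  move: upper lower; rewrite -opprB gap.
  move: IH; set e := (n.+1%:R^-1)%R.
  by lra.
have bound n : (a 1 - a 0 <= b 1 - b 0 + (v 1 - v 0) / n.+1%:R)%R.
  by have := step n n.+1 (leqnn _); rewrite divff ?pnatr_eq0.
(* A positive excess [d] would be at most [(v 1 - v 0) / n.+1] for every [n], against the
   Archimedean property. *)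
pose d := (a 1 - a 0 - (b 1 - b 0))%R.
rewrite leNgt -subr_gt0 -/d; apply/negP => d_gt0.
have [n dn] : exists n : nat, ((v 1%R - v 0%R) / d < n.+1%:R)%R.
  exists (Num.truncn ((v 1%R - v 0%R) / d)); exact: truncnS_gt.
have := bound n; rewrite -lerBlDl -/d ler_pdivlMr ?ltr0n//.
by move: dn; rewrite ltr_pdivrMr// mulrC => /lt_le_trans/[apply]; rewrite ltxx.
Qed.

(** With [q] running from [y] to [x], the number [ip (u (q s)) (x - y)] is a common slope at [s] of
    [a] and [b] composed with [q]; the one-variable comparison then applies in both directions. *)
Lemma segment_subgradient (S : set H) (a b : H -> R) (u : H -> H) (x y : H) :
  (forall z w, S z -> S w -> ip (u z) (w - z) <= a w - a z)%R ->
  (forall z w, S z -> S w -> ip (u z) (w - z) <= b w - b z)%R ->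
  (forall t : R, 0 <= t <= 1 -> S (t *: x + (1 - t) *: y))%R ->
  (a x - b x = a y - b y)%R.
Proof.
move=> ua ub Sq.
pose q (t : R) : H := (t *: x + (1 - t) *: y)%R.
have qB s t : (q t - q s = (t - s) *: (x - y))%R.
  rewrite /q opprD addrACA -!scalerBl scalerBr -[in RHS]scaleNr.
  by congr (_ + _ *: _)%R; ring.
have incr (c : H -> R) :
    (forall z w, S z -> S w -> ip (u z) (w - z) <= c w - c z)%R ->
    (forall s t : R, 0 <= s <= 1 -> 0 <= t <= 1 ->
      ip (u (q s)) (x - y) * (t - s) <= c (q t) - c (q s))%R.
  move=> uc s t /Sq qs /Sq qt; have := uc _ _ qs qt.
  by rewrite qB ipZr mulrC.
have q0 : q 0%R = y by rewrite /q scale0r add0r subr0 scale1r.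
have q1 : q 1%R = x by rewrite /q scale1r subrr scale0r addr0.
have := le_increment_subgradient (incr a ua) (incr b ub).
have := le_increment_subgradient (incr b ub) (incr a ua).
by rewrite q0 q1; lra.
Qed.

(** Subgradients exist only at finite values, so the difference is real on [C]. It is constant on
    each segment of a path, hence equal everywhere to its value at a base point. *)
Lemma polygonally_connected_eq_up_to_cst theta1 theta2 (C : set H) :
  avoids_ninfty theta1 -> avoids_ninfty theta2 -> polygonally_connected C ->
  (forall x, C x -> exists u,
     subdifferential ip theta1 x u /\ subdifferential ip theta2 x u) ->
  exists K : R, forall x, C x -> theta1 x = theta2 x + K%:E.
Proof.
move=> N1 N2 [[x0 Cx0] path] common.
have /choice[u uP] : forall x, exists u, C x ->
    subdifferential ip theta1 x u /\ subdifferential ip theta2 x u.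
  move=> x; have [/common[u ux]|nCx] := pselect (C x); first by exists u.
  by exists 0%R.
have fin1 x : C x -> theta1 x \is a fin_num.
  by move=> /uP[/(subdifferential_fin_num N1)].
have fin2 x : C x -> theta2 x \is a fin_num.
  by move=> /uP[_ /(subdifferential_fin_num N2)].
pose d x : R := (fine (theta1 x) - fine (theta2 x))%R.
exists (d x0) => x Cx.
suff dx : (d x = d x0)%R.
  rewrite -dx -(fineK (fin1 _ Cx)) -(fineK (fin2 _ Cx)) -EFinD /d /=.
  by congr EFin; ring.
have [n [p [p0 pn pC]]] := path _ _ Cx0 Cx.
have dp k : (k <= n)%N -> (d (p k) = d (p 0%N))%R.
  elim: k => // k IH kn; rewrite -IH 1?ltnW//; apply/esym.
  apply: (segment_subgradient (a := fine \o theta1) (b := fine \o theta2)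
      (S := C) (u := u)) => [z w Cz Cw|z w Cz Cw|t]; last exact: pC.
    by apply: (subdifferential_fine N1); [exact: (uP z Cz).1|exact: fin1].
  by apply: (subdifferential_fine N2); [exact: (uP z Cz).2|exact: fin2].
by rewrite -pn dp// p0.
Qed.

End subgradients.

Section bregman_prox.
Context {R : realType} {H : completeNormedModType R} (ip : {dot H for idfun}).
Context (ip_norm : induces_norm ip) (Y : set H) (f : H -> H).
Context (h : H -> \bar R) (gradh : H -> H) (h_ninfty : avoids_ninfty h).
Implicit Types (phi g psi : H -> \bar R).

Lemma fin_dom x : dom h x -> h x \is a fin_num.
Proof. by move=> hx; rewrite fin_numE h_ninfty -ltey. Qed.

Lemma avoids_ninftyD phi : avoids_ninfty phi ->
  avoids_ninfty (fun x => h x + phi x).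
Proof. by move=> phiN x; rewrite adde_eq_ninfty negb_or h_ninfty phiN. Qed.

(** As a function of [z], the objective is [h z + phi z - ip (gradh y) z] plus a constant, finite
    because [y] lies in [dom h]. *)
Lemma argmin_left_bregman phi y x : avoids_ninfty phi -> dom h y ->
  argmin (fun x => bregman ip h gradh x y + phi x) x <->
  subdifferential ip (fun x => h x + phi x) x (gradh y).
Proof.
move=> phiN hy; have := fin_dom hy; rewrite /argmin /subdifferential /bregman hy.
case: (h y) => [c||]// _.
have objE z : h z - c%:E - (ip (gradh y) (z - y))%:E + phi z =
    h z + phi z + (ip (gradh y) y - c - ip (gradh y) z)%:E.
  move: (h_ninfty z) (phiN z); case: (h z) => [a||]//; case: (phi z) => [b||]// _ _.
  by rewrite -!EFinD ipBr; congr EFin; ring.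
have shift_lty (e : \bar R) (r : R) : (e + r%:E < +oo) = (e < +oo).
  by case: e => [a||]//; rewrite !ltry.
have shift_le (e e' : \bar R) (r s : R) :
    (e + r%:E <= e' + s%:E) = (e + (r - s)%:E <= e').
  case: e => [a||]; case: e' => [b||]; rewrite ?leNye ?leey//.
  by rewrite -!EFinD !lee_fin; apply/idP/idP; lra.
have slopeE z : (ip (gradh y) y - c - ip (gradh y) x -
    (ip (gradh y) y - c - ip (gradh y) z) = ip (gradh y) (z - x))%R.
  by rewrite ipBr; ring.
rewrite /= objE shift_lty.
by split=> -[fin le]; split=> // z; have := le z; rewrite objE shift_le slopeE.
Qed.

Lemma left_bregman_prox_subgradient phi y :
  left_bregman_prox ip h gradh Y f phi -> Y y ->
  subdifferential ip (fun x => h x + phi x) (f y) (gradh y).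
Proof.
move=> prox Yy; have [Yh _] := left_bregman_prox_dom h_ninfty prox.
by have [phiN opt] := prox; apply/argmin_left_bregman => //; [exact: Yh|exact: opt].
Qed.

(** Interpolates [h + phi] at the points [f y] with slopes [gradh y]. The identity is confined to
    the image: elsewhere its left side is [+oo], while [h + phi] may be finite. *)
Lemma left_potential_of_prox phi : Y !=set0 ->
  left_bregman_prox ip h gradh Y f phi ->
  exists g, left_potential ip gradh Y f g /\
    forall x, (f @` Y) x -> g x + chi (f @` Y) x = h x + phi x.
Proof.
move=> Y0 prox; have [phiN _] := prox.
pose theta x := h x + phi x.
have thN : avoids_ninfty theta by exact: avoids_ninftyD.
have sub y : Y y -> subdifferential ip theta (f y) (gradh y).
  exact: left_bregman_prox_subgradient.
have thfin y : Y y -> theta (f y) \is a fin_num.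
  by move=> /sub; exact: subdifferential_fin_num.
have [|g [gN gC gL gY]] := @subgradient_interpolation _ _ ip ip_norm _ Y f gradh
    (fun y => fine (theta (f y))) Y0.
  move=> i j Yi Yj; rewrite addrC -lerBrDr.
  by apply: (subdifferential_fine thN); [exact: sub|exact: thfin].
exists g; split.
  by split=> // x _ _ [y [Yy /= <-] <-]; exact: (gY y Yy).2.
move=> x fYx; rewrite /chi mem_set// adde0.
by have [y Yy <-] := fYx; rewrite (gY y Yy).1 fineK//; exact: thfin.
Qed.

(** Taking [phi = g - h] on the image and [+oo] elsewhere gives [h + phi = g + chi]. Adding [chi]
    raises [g] only off the image, so [gradh y] remains a subgradient at [f y]. *)
Lemma left_prox_of_potential g : within_dom h Y f ->
  left_potential ip gradh Y f g ->
  exists phi, left_bregman_prox ip h gradh Y f phi /\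
    forall x, g x + chi (f @` Y) x = h x + phi x.
Proof.
move=> [Yh fYh] [gN gC gL gY].
pose phi x := if x \in f @` Y then g x - h x else +oo.
have sub y : Y y -> subdifferential ip g (f y) (gradh y).
  by move=> Yy; apply: (gY (f y)); [exists y|exists y].
have phiE x : g x + chi (f @` Y) x = h x + phi x.
  rewrite /phi /chi; case: ifPn => [/set_mem fYx|_].
    by rewrite adde0 addeC subeK// fin_dom//; exact: fYh.
  by rewrite !addey.
have phiN : avoids_ninfty phi.
  move=> x; rewrite /phi; case: ifPn => // /set_mem [y Yy <-].
  have gfin := subdifferential_fin_num gN (sub y Yy).
  have hfy : h (f y) \is a fin_num by apply/fin_dom/fYh; exists y.
  by rewrite -(fineK gfin) -(fineK hfy).
exists phi; split=> //; split=> // y Yy.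
apply/argmin_left_bregman => //; first exact: Yh.
rewrite /subdifferential /=; have [gfy gle] := sub y Yy.
have chify : chi (f @` Y) (f y) = 0 :> \bar R by rewrite /chi mem_set//; exists y.
split=> [|x']; rewrite -!phiE chify adde0//.
by apply: le_trans (gle x') _; rewrite leeDl// /chi; case: ifP; rewrite ?leey.
Qed.

(** When [y] is in [dom h] and [f y] is optimal, this is [h y] minus the minimum of
    [D_h(y, .) + phi]. *)
Definition right_value phi y : \bar R :=
  (ip (gradh (f y)) (y - f y)%R)%:E + h (f y) - phi (f y).

Lemma right_potential_of_prox phi : Y !=set0 ->
  right_bregman_prox ip h gradh Y f phi ->
  exists psi, right_potential ip gradh Y f psi /\
    forall y, Y y -> psi y = right_value phi y.
Proof.
move=> Y0 prox; have [Yh fYh] := right_bregman_prox_dom h_ninfty prox.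
have [phiN opt] := prox.
have hffin y : Y y -> h (f y) \is a fin_num.
  by move=> Yy; apply: fin_dom; apply: fYh; exists y.
have phifin y : Y y -> phi (f y) \is a fin_num.
  move=> Yy; have [+ _] := opt y Yy; rewrite fin_numE phiN /= /bregman.
  have hfy : h (f y) < +oo by apply: fYh; exists y.
  rewrite hfy -(fineK (hffin _ Yy)) -(fineK (fin_dom (Yh _ Yy))).
  by case: (phi (f y)).
have valE y : Y y -> right_value phi y = (fine (right_value phi y))%:E.
  by move=> Yy; rewrite /right_value -(fineK (hffin _ Yy)) -(fineK (phifin _ Yy)).
have [|g [gN gC gL gY]] := @subgradient_interpolation _ _ ip ip_norm _ Y id
    (gradh \o f) (fun y => fine (right_value phi y)) Y0.
  (* Optimality of [f i] is tested against the competitor [f j]; [h i] cancels and the compatibility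
     condition for the slopes [gradh (f j)] remains. *)
  move=> i j Yi Yj; have [_ /(_ (f j))] := opt i Yi; rewrite /bregman.
  have hfj : h (f j) < +oo by apply: fYh; exists j.
  have hfi : h (f i) < +oo by apply: fYh; exists i.
  rewrite hfj hfi /right_value.
  rewrite -(fineK (hffin _ Yi)) -(fineK (hffin _ Yj)) -(fineK (fin_dom (Yh _ Yi))).
  rewrite -(fineK (phifin _ Yi)) -(fineK (phifin _ Yj)) /=.
  by rewrite lee_fin !ipBr; lra.
exists g; split=> [|y Yy]; last by rewrite (gY y Yy).1 -valE.
by split=> // y Yy; exact: (gY y Yy).2.
Qed.

Lemma right_prox_of_potential psi : within_dom h Y f ->
  right_potential ip gradh Y f psi ->
  exists phi, right_bregman_prox ip h gradh Y f phi /\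
    forall y, Y y -> psi y = right_value phi y.
Proof.
move=> [Yh fYh] [psiN psiC psiL psiY].
have psifin y : Y y -> psi y \is a fin_num.
  by move=> /psiY; exact: subdifferential_fin_num.
pose val y : R := (ip (gradh (f y)) (y - f y) + fine (h (f y)) - fine (psi y))%R.
(* The subgradient inequalities from [y] to [y'] and back have the same slope, so together they form
   an equality. *)
have val_fibre y y' : Y y -> Y y' -> f y = f y' -> val y = val y'.
  move=> Yy Yy' fyy'.
  have := subdifferential_fine psiN (psiY _ Yy) (psifin _ Yy').
  have := subdifferential_fine psiN (psiY _ Yy') (psifin _ Yy).
  by rewrite /val fyy' !ipBr; lra.
(* [s] selects a point in each fibre; its values off the image are fillers, masked by [+oo] in
   [phi]. *)
have /choice[s sP] : forall x, exists y, (f @` Y) x -> Y y /\ f y = x.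
  move=> x; have [[y Yy <-]|nfY] := pselect ((f @` Y) x); first by exists y.
  by exists x.
pose phi x := if x \in f @` Y then (val (s x))%:E else +oo.
have phif y : Y y -> phi (f y) = (val y)%:E.
  move=> Yy; have fYy : (f @` Y) (f y) by exists y.
  rewrite /phi mem_set//; have [Ys fs] := sP _ fYy.
  by rewrite (val_fibre _ y).
exists phi; split; last first.
  move=> y Yy; rewrite /right_value phif// /val.
  have hfy : h (f y) \is a fin_num by apply/fin_dom/fYh; exists y.
  rewrite -(fineK (psifin _ Yy)) -(fineK hfy) -!EFinD /=.
  by congr EFin; ring.
split=> [x|y Yy]; first by rewrite /phi; case: ifP.
have hy := fin_dom (Yh _ Yy).
have hff z : Y z -> h (f z) < +oo by move=> Yz; apply: fYh; exists z.
have objE z : Y z -> bregman ip h gradh y (f z) + phi (f z) =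
    (fine (h y) + ip (gradh (f z)) (z - y) - fine (psi z))%:E.
  move=> Yz; rewrite /bregman hff// phif// /val.
  have := fin_dom (hff _ Yz); move: (h (f z)) => [c||]// _.
  rewrite -(fineK hy) -!EFinD; congr EFin => /=.
  by rewrite !ipBr; ring.
rewrite /argmin /=; split=> [|x]; first by rewrite objE// ltry.
(* Against [f z], optimality is the subgradient inequality of [psi] at [z] evaluated at [y]; off the
   image the objective is [+oo]. *)
have [[z Yz <-]|nfY] := pselect ((f @` Y) x).
  rewrite !objE// lee_fin subrr ip0r.
  have := subdifferential_fine psiN (psiY _ Yz) (psifin _ Yy).
  by rewrite !ipBr; lra.
have -> : phi x = +oo by rewrite /phi memNset.
rewrite addey ?leey// /bregman; case: ifP => // hx.
by rewrite -(fineK hy) -(fineK (fin_dom hx)).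
Qed.

End bregman_prox.

Theorem corollary5 (R : realType) (H : completeNormedModType R)
    (ip : {dot H for idfun}) (ip_norm : induces_norm ip)
    (Y : set H) (Y_neq0 : Y !=set0) (f : H -> H)
    (h : H -> \bar R) (gradh : H -> H)
    (h_ninfty : avoids_ninfty h) (h_proper : dom h !=set0)
    (h_convex : econvex h) (h_open : open (dom h))
    (h_grad : gradient_on_dom ip h gradh) :
  (* (a) *)
  [/\ within_dom h Y f ->
        ((exists phi : H -> \bar R, left_bregman_prox ip h gradh Y f phi) <->
         (exists g : H -> \bar R, left_potential ip gradh Y f g)),
      within_dom h Y f -> forall g : H -> \bar R,
        left_potential ip gradh Y f g ->
        exists phi : H -> \bar R, left_bregman_prox ip h gradh Y f phi /\
          forall x, g x + chi (f @` Y) x = h x + phi x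
    & forall phi : H -> \bar R,
        left_bregman_prox ip h gradh Y f phi ->
        exists g : H -> \bar R, left_potential ip gradh Y f g /\
          forall x, (f @` Y) x -> g x + chi (f @` Y) x = h x + phi x]
  /\
  (* (b) *)
  (forall phi g : H -> \bar R,
     left_bregman_prox ip h gradh Y f phi ->
     left_potential ip gradh Y f g ->
     forall C : set H, C `<=` f @` Y -> polygonally_connected C ->
     exists K : R, forall x, C x -> g x = h x + phi x + K%:E)
  /\
  (* (c) *)
  [/\ within_dom h Y f ->
        ((exists phi : H -> \bar R, right_bregman_prox ip h gradh Y f phi) <->
         (exists psi : H -> \bar R, right_potential ip gradh Y f psi)),
      within_dom h Y f -> forall psi : H -> \bar R,
        right_potential ip gradh Y f psi ->
        exists phi : H -> \bar R, right_bregman_prox ip h gradh Y f phi /\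
          forall y, Y y ->
            psi y = (ip (gradh (f y)) (y - f y)%R)%:E + h (f y) - phi (f y)
    & forall phi : H -> \bar R,
        right_bregman_prox ip h gradh Y f phi ->
        exists psi : H -> \bar R, right_potential ip gradh Y f psi /\
          forall y, Y y ->
            psi y = (ip (gradh (f y)) (y - f y)%R)%:E + h (f y) - phi (f y)]
  /\
  (* (d) *)
  (forall phi psi : H -> \bar R,
     right_bregman_prox ip h gradh Y f phi ->
     right_potential ip gradh Y f psi ->
     forall C' : set H, C' `<=` Y -> polygonally_connected C' ->
     exists K' : R, forall y, C' y ->
       psi y = (ip (gradh (f y)) (y - f y)%R)%:E + h (f y) - phi (f y) + K'%:E).
Proof.
split; [split|split; [|split; [split|]]].
- move=> fdom; split=> [[phi prox]|[g pot]].
    by have [g [? _]] := left_potential_of_prox ip_norm h_ninfty Y_neq0 prox;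
      exists g.
  by have [phi [? _]] := left_prox_of_potential h_ninfty fdom pot; exists phi.
- by move=> fdom g; exact: left_prox_of_potential.
- by move=> phi; exact: left_potential_of_prox.
- move=> phi g prox [gN _ _ gY] C CfY Cconn.
  have [phiN _] := prox.
  apply: (@polygonally_connected_eq_up_to_cst _ _ ip) => //.
    exact: avoids_ninftyD.
  move=> x /CfY[y Yy <-]; exists (gradh y); split.
    by apply: (gY (f y)); [exists y|exists y].
  exact: left_bregman_prox_subgradient prox Yy.
- move=> fdom; split=> [[phi prox]|[psi pot]].
    by have [psi [? _]] := right_potential_of_prox ip_norm h_ninfty Y_neq0 prox;
      exists psi.
  by have [phi [? _]] := right_prox_of_potential h_ninfty fdom pot; exists phi.
- by move=> fdom psi; exact: right_prox_of_potential.
- by move=> phi; exact: right_potential_of_prox.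
(* The right-hand formula is controlled only on [Y], so [psi] is compared with a convex potential
   [psi'] that equals it there and has the same subgradients [gradh (f y)]. *)
- move=> phi psi prox [psiN _ _ psiY] C CY Cconn.
  have [psi' [[psi'N _ _ psi'Y] psi'E]] :=
    right_potential_of_prox ip_norm h_ninfty Y_neq0 prox.
  have [|K KP] := polygonally_connected_eq_up_to_cst (ip := ip) psiN psi'N Cconn.
    by move=> y /CY Yy; exists (gradh (f y)); split; [exact: psiY|exact: psi'Y].
  by exists K => y Cy; rewrite KP// psi'E//; exact: CY.
Qed.
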